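(* Let $f:\mathbb{R}\to\mathbb{R}$ be a continuous function with compact support contained in $[0,\infty)$. If there exists $x_0>0$ such that $f(x_0)>0$ and such that $f(x)\ge0$ for all $x\ge x_0$, then $\int_{\mathbb{R}}f(x)x^k\,dx>0$ for all sufficiently large $k\in\mathbb{N}$. Furthermore, for every $t\in(0,x_0)$ we have $\frac{1}{t^k}\int_{\mathbb{R}}f(x)x^k\,dx\to\infty$ for $k\to\infty$.
   Context: $\mathbb{N}$ is the set of natural numbers including $0$. *)

(* Defs.v *)
From mathcomp Require Import all_boot all_order all_algebra.
From mathcomp Require Import all_classical all_reals all_analysis.

Set Implicit Arguments.
Unset Strict Implicit.
Unset Printing Implicit Defensive.

Import Order.TTheory GRing.Theory Num.Theory.
Import numFieldNormedType.Exports.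

Local Open Scope classical_set_scope.
Local Open Scope ring_scope.

(* The topological support of f, not to be confused with the predicate
   [GRing.support], which does not take the closure. *)
Definition tsupport (R : realType) (f : R -> R) : set R :=
  closure [set x | f x != 0].

(* Main.v *)
Require Import Defs.
From mathcomp Require Import all_boot all_order all_algebra.
From mathcomp Require Import all_classical all_reals all_analysis.
From mathcomp Require Import measurable_realfun.

Set Implicit Arguments.
Unset Strict Implicit.
Unset Printing Implicit Defensive.

Import Order.TTheory GRing.Theory Num.Theory.
Import numFieldNormedType.Exports.

Local Open Scope classical_set_scope.
Local Open Scope ring_scope.

(** The moments [\int f x * x ^+ k] feel the region where [x] is largest, and
    there [f] is nonnegative.  By continuity [f] stays above some [m > 0] on an
    interval [[c, d]] lying strictly to the right of [x0], and this interval
    contributes at least [m * (d - c) * c ^+ k] to the moment.  Negative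
    contributions can come only from [[0, x0]], where they are at most
    [B * x0 * x0 ^+ k] in absolute value, [- B] being a lower bound of [f]
    there.  Hence the moment is at least [A * c ^+ k - D * x0 ^+ k] with [A > 0]
    and [c > x0] ([moment_lower_bound]).

    Dividing by [x0 ^+ k] leaves [A * (c / x0) ^+ k - D], which tends to
    infinity as [c / x0 > 1].  So already at the endpoint [t = x0] the scaled
    moments diverge ([scaled_moment_cvgy]).  This gives both claims: the moments
    are eventually positive, and once they are, replacing [x0] by a smaller [t]
    only increases the quotient. *)

Lemma cvg_exprn_pinfty (R : realType) (q : R) :
  1 < q -> q ^+ k @[k --> \oo] --> +oo.
Proof.
move=> q1; have q0 : 0 < q by exact: lt_trans q1.
apply/gtr0_cvgV0; first by apply: nearW => k; rewrite exprn_gt0.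
rewrite [X in X @ _](_ : _ = GRing.exp q^-1); last first.
  by apply/funext => k; rewrite /= exprVn.
by apply: cvg_expr; rewrite gtr0_norm ?invr_gt0// invf_lt1.
Qed.

Lemma tsupport_eq0 (R : realType) (f : R -> R) (x : R) :
  ~ tsupport f x -> f x = 0.
Proof.
move=> nfx; apply/eqP; apply: contrapT => /negP fx; apply: nfx.
exact: subset_closure.
Qed.

Lemma compact_support_integrable (R : realType) (f g : R -> R) :
  compact (tsupport f) -> continuous f -> continuous g ->
  lebesgue_measure.-integrable setT (EFin \o (fun x => f x * g x)).
Proof.
move=> cpt cf cg.
(* The product agrees with its restriction to the support of [f], where
   continuity on a compact set gives integrability. *)
have -> : EFin \o (fun x => f x * g x) =
    (EFin \o (fun x => f x * g x)) \_ (tsupport f).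
  apply/funext => x; rewrite patchE; case: ifPn => //.
  by rewrite notin_setE /= => /tsupport_eq0 ->; rewrite mul0r.
have fg_cont : continuous (fun x => f x * g x).
  by move=> x; apply: cvgM; [exact: cf | exact: cg].
apply/(integrable_mkcond _ _).1; first exact: compact_measurable.
exact: continuous_compact_integrable cpt (continuous_subspaceT fg_cont).
Qed.

Lemma integral_indic_itv (R : realType) (a b : R) : a <= b ->
  \int[lebesgue_measure]_x (\1_(`[a, b]%classic : set R) x : R) = b - a.
Proof.
move=> ab; rewrite /Rintegral integral_indic//= setIT lebesgue_measure_itv/=.
rewrite lte_fin; case: ltP => //= ba.
by apply/esym/eqP; rewrite subr_eq0 eq_le ba ab.
Qed.

Lemma gt0_right_window (R : realType) (f : R -> R) (x0 : R) :
  continuous f -> 0 < f x0 ->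
  exists c d m : R, [/\ x0 < c, c < d, 0 < m &
    forall x, c <= x <= d -> m <= f x].
Proof.
move=> cf fx0.
have hlt : f x0 / 2 < f x0 by rewrite ltr_pdivrMr// mulr_natr mulr2n ltrDl.
have /nbhs_ballP[e /= e0 He] : \forall x \near x0, f x0 / 2 < f x.
  exact: (cvgr_gt (f x0) (cf x0)).
exists (x0 + e / 3), (x0 + e / 2), (f x0 / 2).
split; rewrite ?ltrDl ?divr_gt0//.
  by rewrite ltrD2l ltr_pM2l// ltf_pV2 ?posrE// ltr_nat.
move=> x /andP[cx xd]; apply/ltW/He; rewrite /ball/=.
have x0x : x0 <= x by rewrite (le_trans _ cx)// lerDl divr_ge0// ltW.
rewrite ler0_norm ?subr_le0// opprB ltrBlDl (le_lt_trans xd)// ltrD2l.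
by rewrite ltr_pdivrMr// mulr_natr mulr2n ltrDl.
Qed.

(** The integrand dominates pointwise the step function that equals
    [m * c ^+ k] on the window of [gt0_right_window] and [- B * x0 ^+ k] on
    [[0, x0]]; integrating the step function gives the bound. *)
Lemma moment_lower_bound (R : realType) (f : R -> R) (x0 : R) :
  continuous f -> compact (tsupport f) ->
  tsupport f `<=` [set x | 0 <= x] ->
  0 < x0 -> 0 < f x0 -> (forall x, x0 <= x -> 0 <= f x) ->
  exists A c D : R, [/\ 0 < A, x0 < c &
    forall k, A * c ^+ k - D * x0 ^+ k <=
      \int[lebesgue_measure]_x (f x * x ^+ k)].
Proof.
move=> cf cpt supp x00 fx0 f0.
have [c [d [m [x0c cd m0 mf]]]] := gt0_right_window cf fx0.
have [y _ fy] := EVT_min (ltW x00) (continuous_subspaceT cf).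
pose B := `|f y|.
have fB x : 0 <= x <= x0 -> - B <= f x.
  by move=> xi; rewrite (le_trans _ (fy x _))// ?in_itv// lerNl /B -normrN ler_norm.
have c0 : 0 < c by exact: lt_trans x0c.
exists (m * (d - c)), c, (B * x0); split=> //.
  by rewrite mulr_gt0// subr_gt0.
move=> k.
pose I (a b : R) : R -> R := \1_(`[a, b]%classic : set R).
have iI a b : lebesgue_measure.-integrable setT (EFin \o I a b).
  exact: integrable_indic_itv.
have iZ r a b : lebesgue_measure.-integrable setT
    (EFin \o (fun x => r * I a b x)).
  by apply: (integrableZl measurableT r (iI a b)).
have -> : m * (d - c) * c ^+ k - B * x0 * x0 ^+ k =
    \int[lebesgue_measure]_x (m * c ^+ k * I c d x - B * x0 ^+ k * I 0 x0 x).
  rewrite RintegralB// !RintegralZl// !integral_indic_itv ?(ltW cd) ?(ltW x00)//.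
  by rewrite subr0 mulrAC [in X in _ - X]mulrAC.
apply: le_Rintegral => //.
- exact: (integrableB measurableT (iZ _ _ _) (iZ _ _ _)).
- by apply: compact_support_integrable => // x; exact: exprn_continuous.
move=> x _; rewrite /I !indicE !mem_setE !in_itv/=.
have [xn|xp] := ltP x 0.
  rewrite (@tsupport_eq0 _ f x) ?mul0r; last first.
    by move=> /supp; rewrite /= leNgt xn.
  by rewrite [c <= x]leNgt (lt_trans xn c0)/= !mulr0 subr0.
have xk0 : 0 <= x ^+ k by exact: exprn_ge0.
have [xx0|x0x] := leP x x0.
  rewrite [c <= x]leNgt (le_lt_trans xx0 x0c)/= mulr0 mulr1 sub0r.
  rewrite -mulNr (@le_trans _ _ (- B * x ^+ k))//.
    by rewrite ler_wnM2l ?oppr_le0 /B ?normr_ge0// lerXn2r// nnegrE// ltW.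
  by rewrite ler_wpM2r// fB// xp.
rewrite mulr0 subr0.
have [/andP[cx xd]|_] := boolP (c <= x <= d); last first.
  by rewrite mulr0 mulr_ge0// f0// ltW.
rewrite mulr1 ler_pM ?(ltW m0) ?exprn_ge0 ?(ltW c0)//; first by rewrite mf// cx.
by rewrite lerXn2r// nnegrE// ltW.
Qed.

Lemma scaled_moment_cvgy (R : realType) (f : R -> R) (x0 : R) :
  continuous f -> compact (tsupport f) ->
  tsupport f `<=` [set x | 0 <= x] ->
  0 < x0 -> 0 < f x0 -> (forall x, x0 <= x -> 0 <= f x) ->
  (x0 ^+ k)^-1 * \int[lebesgue_measure]_x (f x * x ^+ k)
    @[k --> \oo] --> +oo.
Proof.
move=> cf cpt supp x00 fx0 f0.
have [A [c [D [A0 x0c bnd]]]] := moment_lower_bound cf cpt supp x00 fx0 f0.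
have q1 : 1 < c / x0 by rewrite ltr_pdivlMr// mul1r.
apply/cvgryPge => M.
(* [(M + D) / A] is the size of [(c / x0) ^+ k] from which
   [A * (c / x0) ^+ k - D] exceeds [M]. *)
have /cvgryPge/(_ ((M + D) / A)) := cvg_exprn_pinfty q1.
apply: filterS => k; rewrite ler_pdivrMr// -lerBrDr expr_div_n => /le_trans.
apply; rewrite ler_pdivlMl ?exprn_gt0//.
apply: le_trans (bnd k).
rewrite mulrBr [x0 ^+ k * D]mulrC mulrA mulrCA divff ?expf_neq0 ?gt_eqF//.
by rewrite mulr1 [c ^+ k * A]mulrC.
Qed.

Theorem lemma8 (R : realType) (f : R -> R) (x0 : R)
  (f_cont : continuous f)
  (f_compact : compact (tsupport f))
  (f_supp : tsupport f `<=` [set x | 0 <= x])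
  (x0_gt0 : 0 < x0)
  (fx0_gt0 : 0 < f x0)
  (f_ge0 : forall x : R, x0 <= x -> 0 <= f x) :
  (\forall k \near \oo, 0 < \int[lebesgue_measure]_x (f x * x ^+ k)) /\
  (forall t : R, 0 < t -> t < x0 ->
    (t ^+ k)^-1 * \int[lebesgue_measure]_x (f x * x ^+ k)
      @[k --> \oo] --> +oo).
Proof.
have scaled := scaled_moment_cvgy f_cont f_compact f_supp x0_gt0 fx0_gt0 f_ge0.
have pos : \forall k \near \oo, 0 < \int[lebesgue_measure]_x (f x * x ^+ k).
  have /cvgryPgt/(_ 0) := scaled.
  by apply: filterS => k; rewrite pmulr_rgt0// invr_gt0 exprn_gt0.
split=> // t t0 tx0; apply: ger_cvgy scaled.
apply: filterS pos => k Ik.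
rewrite ler_pM2r// lef_pV2 ?posrE ?exprn_gt0//.
by rewrite lerXn2r// ?nnegrE ltW.
Qed.
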